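(* Let $s,t>0$. The process with generator $\mathcal L$ is self-dual with self-duality function $D_{s,t}$: for all $(k,l),(n,m)\in\mathbb N^2$ and all times $r>0$, $$\widehat{\mathbb E}_{n,m}\,D_{s,t}(k,l;N_r,M_r)=\widehat{\mathbb E}_{k,l}\,D_{s,t}(N_r,M_r;n,m).$$
   Context: $\mathbb N=\{0,1,2,\dots\}$; $B(s,t)=\Gamma(s)\Gamma(t)/\Gamma(s+t)$; time is denoted by $r$. $(N_r,M_r)_{r\ge0}$ is the continuous-time Markov chain on $\mathbb N^2$ with generator $$\mathcal Lf(n,m)=\sum_{k=0}^n\sum_{l=0}^mr_{s,t}(n,m;k,l)\big(f(n-k+l,\;m-l+k)-f(n,m)\big),$$ $$r_{s,t}(n,m;k,l)=\frac{n!\,m!}{B(s,t)^2}\,\frac{\Gamma(k+s)\,\Gamma(m-l+t)\,\Gamma(n-k+t)\,\Gamma(l+s)}{\Gamma(s+t+n)\,\Gamma(s+t+m)\,(n-k)!\,k!\,(m-l)!\,l!},$$ and $\widehat{\mathbb E}_{n,m}$ denotes expectation for the chain started from $(N_0,M_0)=(n,m)$. $D_{s,t}(k,l;n,m)=d_{s,t}(k,n)\,d_{s,t}(l,m)$, where $$d_{s,t}(k,n)=\frac{n!}{(n-k)!}\,\frac{\Gamma(s+t)}{\Gamma(s+t+k)}$$ and negative factorials are interpreted as infinite, so $d_{s,t}(k,n)=0$ for $k>n$. *)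

(* Defs.v *)
From HB Require Import structures.
From mathcomp Require Import all_boot all_order all_algebra.
From mathcomp Require Import all_classical all_reals all_analysis.

Set Implicit Arguments.
Unset Strict Implicit.
Unset Printing Implicit Defensive.

Import Order.TTheory GRing.Theory Num.Theory.
Import numFieldNormedType.Exports.

Local Open Scope classical_set_scope.
Local Open Scope ring_scope.

(* Euler's integral; only meaningful for 0 < a. *)
Definition Gamma (R : realType) (a : R) : R :=
  \int[@lebesgue_measure R]_(x in `]0, +oo[) (x `^ (a - 1) * expR (- x)).

Definition Beta (R : realType) (s t : R) : R :=
  Gamma s * Gamma t / Gamma (s + t).

(* The truncated subtractions below are only evaluated for k <= n, l <= m. *)
Definition rate (R : realType) (s t : R) (n m k l : nat) : R :=
  (n`!%:R * m`!%:R) / Beta s t ^+ 2 *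
  ((Gamma (k%:R + s) * Gamma ((m - l)%N%:R + t) *
    Gamma ((n - k)%N%:R + t) * Gamma (l%:R + s)) /
   (Gamma (s + t + n%:R) * Gamma (s + t + m%:R) *
    (n - k)`!%:R * k`!%:R * (m - l)`!%:R * l`!%:R)).

Definition generator (R : realType) (s t : R) (f : nat * nat -> R)
    (x : nat * nat) : R :=
  let: (n, m) := x in
  \sum_(0 <= k < n.+1) \sum_(0 <= l < m.+1)
    rate s t n m k l * (f ((n - k + l)%N, (m - l + k)%N) - f (n, m)).

(* [X] is the coordinate process and [P x] the law of the chain started from
   [x]; time runs over the nonnegative reals, and [X r] is unconstrained for
   [r < 0].  In the Markov property, [h] is a finite list of past
   (time, state) observations; the conditional probability
   P_x(X_(u+r) = z | X_u = y, past) = P_y(X_r = z)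
   is multiplied out, so that null events need no special treatment. *)
Record is_markov_chain (R : realType) (d : measure_display)
    (Omega : measurableType d) (L : (nat * nat -> R) -> nat * nat -> R)
    (P : nat * nat -> probability Omega R)
    (X : R -> Omega -> nat * nat) : Prop := {
  chain_measurable : forall r : R, 0 <= r -> measurable_fun [set: Omega] (X r) ;
  chain_start : forall x, P x [set w | X 0 w = x] = 1%E ;
  chain_markov : forall (x y z : nat * nat) (h : seq (R * (nat * nat)))
      (u r : R), 0 <= u -> 0 <= r ->
    (forall e : R * (nat * nat), e \in h -> 0 <= e.1 <= u) ->
    let past := [set w | X u w = y /\
      forall e : R * (nat * nat), e \in h -> X e.1 w = e.2] in
    P x (past `&` [set w | X (u + r) w = z]) =
    (P x past * P y [set w | X r w = z])%E ;
  chain_generator : forall (f : nat * nat -> R) (x : nat * nat),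
    (exists C : R, forall y, `|f y| <= C) ->
    (fine ('E_(P x)[fun w => f (X r w)]) - f x) / r @[r --> 0^'+] --> L f x
}.

Definition duality1 (R : realType) (s t : R) (k n : nat) : R :=
  if (k <= n)%N
  then n`!%:R / (n - k)`!%:R * (Gamma (s + t) / Gamma (s + t + k%:R))
  else 0.

Definition duality (R : realType) (s t : R) (y x : nat * nat) : R :=
  duality1 s t y.1 x.1 * duality1 s t y.2 x.2.

(* Main.v *)
(** The rates factor: K and L are independent beta-binomial(s, t) variables on
    [0, n] and [0, m].  The joint factorial moments of (K, n - K) are explicit
    quotients of Gamma values (from Gamma (a + 1) = a * Gamma a alone), so
    expanding the falling factorials of n - K + L and m - L + K by Vandermonde
    gives duality of the generator, L D(y, .)(x) = L D(., x)(y).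

    The generator preserves n + m.  Both the confinement of the chain to the
    finite set n + m = N and the passage from generator to semigroup rest on
    the same remark: an error which is subadditive in time and o(r) at 0
    vanishes, so no differential equation or matrix exponential is needed.
    For the duality the error is E_x D(y, X_r) - E_y D(X_r, x). *)
Require Import Defs.
From HB Require Import structures.
From mathcomp Require Import all_boot all_order all_algebra.
From mathcomp Require Import all_classical all_reals all_analysis.
From mathcomp Require Import measurable_realfun zify ring lra.

Import Order.TTheory GRing.Theory Num.Theory.
Import numFieldNormedType.Exports.

Local Open Scope classical_set_scope.
Local Open Scope ring_scope.

(** * The functional equation of Gamma *)

Section GammaFunction.
Context {R : realType}.
Notation mu := (@lebesgue_measure R).

Let gI (a x : R) : R := x `^ (a - 1) * expR (- x).

Lemma continuous_expRNM (c : R) : continuous (fun x : R => expR (- (c * x))).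
Proof.
move=> x; apply: continuous_comp; last exact: continuous_expR.
by apply: continuousN; apply: continuousM; [exact: cvg_cst|exact: cvg_id].
Qed.

Lemma measurable_expRNM (c : R) (D : set R) :
  measurable_fun D (EFin \o (fun x : R => expR (- (c * x)))).
Proof.
apply/measurable_EFinP; apply: (@measurable_funS _ _ _ _ setT) => //.
apply: continuous_measurable_fun; exact: continuous_expRNM.
Qed.

(** Used with c = 1/2, b = 0 to bound the Gamma integral from above, and with c = b = 1 to bound it
    from below. *)
Lemma integral_expRN (c b : R) : 0 < c ->
  (\int[mu]_(x in `[b, +oo[) (expR (- (c * x)))%:E = (expR (- (c * b)) / c)%:E)%E.
Proof.
move=> c0.
have dE (x : R) : is_derive x 1 (fun y => - (expR (- (c * y)) / c)) (expR (- (c * x))).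
  have -> : (fun y => - (expR (- (c * y)) / c)) =
            (fun y => - c^-1 * expR (- c * y)).
    by apply/funext => y; rewrite mulNr (mulrC c^-1) mulNr.
  apply: is_derive_eq.
  by rewrite -mulNr /GRing.scale/= mulr1; field; rewrite gt_eqF.
have cE := continuous_expRNM c.
rewrite (@ge0_continuous_FTC2y _ _ (fun y => - (expR (- (c * y)) / c)) b 0).
- by rewrite add0e -EFinN opprK.
- by move=> x _; exact: expR_ge0.
- exact: continuous_subspaceT.
- rewrite -oppr0 -[X in - X](mul0r c^-1).
  apply: cvgN; apply: cvgMr_tmp.
  apply: (@cvg_comp _ _ _ (fun x => c * x) (fun x => expR (- x)) _ (pinfty_nbhs R));
    last exact: cvgr_expR.
  exact: gt0_cvgMry.
- by move=> x _; have [] := dE x.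
- apply: cvg_at_right_filter; apply: cvgN; apply: cvgMr_tmp; exact: cE.
- by move=> x _; rewrite derive1E; have [] := dE x.
Qed.

(** The inequality 1 + y <= exp y at y = x / (2 a), raised to the power a. *)
Lemma powR_le_expR (a x : R) : 0 < a -> 0 < x ->
  x `^ a <= (2 * a) `^ a * expR (2^-1 * x).
Proof.
move=> a0 x0.
have -> : 2^-1 * x = (x / (2 * a)) * a by field; rewrite gt_eqF.
have a2 : 0 <= 2 * a by rewrite mulr_ge0// ltW.
rewrite expRM -powRM ?expR_ge0//.
apply: ge0_ler_powR; rewrite ?nnegrE ?(ltW a0) ?(ltW x0)//.
  by rewrite mulr_ge0 ?expR_ge0.
rewrite mulrC -ler_pdivrMr; last by rewrite mulr_gt0.
by rewrite (le_trans _ (expR_ge1Dx _))// lerDr.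
Qed.

(** Half of the exponential decay absorbs the power of x; what remains is integrable and tends to 0
    at infinity. *)
Lemma Gamma_integrand_le (a x : R) : 0 < a -> 0 < x ->
  x `^ a * expR (- x) <= (2 * a) `^ a * expR (- (2^-1 * x)).
Proof.
move=> a0 x0.
have -> : - (2^-1 * x) = 2^-1 * x + - x by field.
by rewrite expRD mulrA ler_wpM2r ?expR_ge0 ?powR_le_expR.
Qed.

Let measurable_gI (a : R) (D : set R) :
  measurable_fun D (EFin \o gI a).
Proof.
apply/measurable_EFinP; apply: (@measurable_funS _ _ _ _ setT) => //.
apply: measurable_funM; first exact: measurable_powR.
apply: measurableT_comp; first exact: measurable_expR.
exact: oppr_measurable.
Qed.

(** Gamma before [fine] is applied: as an extended real it can be compared and passed to the limit
    before it is known to be finite. *)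
Let J (a : R) := (\int[mu]_(x in `]0%R, +oo[) (gI a x)%:E)%E.

Let gI_ge0 a x : 0 <= gI a x.
Proof. by rewrite mulr_ge0 ?powR_ge0 ?expR_ge0. Qed.

Let JS_lty (a : R) : 0 < a -> (J (a + 1) < +oo)%E.
Proof.
move=> a0.
apply: (@le_lt_trans _ _
  (((2 * a) `^ a)%:E * \int[mu]_(x in `[0%R, +oo[) (expR (- (2^-1 * x)))%:E)%E);
  last first.
  by rewrite integral_expRN ?invr_gt0// -EFinM ltry.
rewrite -ge0_integralZl//; last 2 first.
- exact: measurable_expRNM.
- by rewrite lee_fin powR_ge0.
apply: (@le_trans _ _ (\int[mu]_(x in `]0%R, +oo[)
    (((2 * a) `^ a)%:E * (expR (- (2^-1 * x)))%:E))%E).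
  apply: ge0_le_integral => //=.
  - by move=> x _; rewrite lee_fin.
  - exact: measurable_gI.
  - by apply: measurable_funeM; exact: measurable_expRNM.
  - move=> x; rewrite in_itv/= andbT => x0.
    by rewrite -EFinM lee_fin /gI addrK Gamma_integrand_le.
apply: ge0_subset_integral => //=.
- by apply: measurable_funeM; exact: measurable_expRNM.
- by move=> x _; rewrite -EFinM lee_fin mulr_ge0 ?powR_ge0 ?expR_ge0.
- by apply: subset_itvr; rewrite bnd_simp.
Qed.

(** On [1, +oo[ the power of x is at least 1, so exp (- x) is a lower bound there. *)
Let JS_gt0 (a : R) : 0 < a -> (0 < J (a + 1))%E.
Proof.
move=> a0.
apply: (@lt_le_trans _ _ (\int[mu]_(x in `[1%R, +oo[) (expR (- (1 * x)))%:E)%E).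
  by rewrite integral_expRN// lte_fin divr_gt0 ?expR_gt0.
apply: (@le_trans _ _ (\int[mu]_(x in `[1%R, +oo[) (gI (a + 1) x)%:E)%E).
  apply: ge0_le_integral => //=.
  - exact: measurable_expRNM.
  - exact: measurable_gI.
  - move=> x; rewrite in_itv/= andbT => x1.
    rewrite lee_fin /gI addrK mul1r ler_peMl ?expR_ge0//.
    by rewrite -(powRr0 x) ler_powR// ltW.
apply: ge0_subset_integral => //=.
- exact: measurable_gI.
- by move=> x _; rewrite lee_fin.
- by apply: subset_itvr; rewrite bnd_simp.
Qed.

Let gI_cvgy (a : R) : 0 < a -> x `^ a * expR (- x) @[x --> +oo] --> 0.
Proof.
move=> a0.
apply: (@squeeze_cvgr _ _ _ _ (fun=> 0)
  (fun x => (2 * a) `^ a * expR (- (2^-1 * x)))).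
- near=> x; rewrite mulr_ge0 ?powR_ge0 ?expR_ge0//=.
  by apply: Gamma_integrand_le => //; near: x; exact: nbhs_pinfty_gt.
- exact: cvg_cst.
- rewrite -(mulr0 ((2 * a) `^ a)); apply: cvgMl_tmp.
  apply: (@cvg_comp _ _ _ (fun x => 2^-1 * x) (fun x => expR (- x)) _ (pinfty_nbhs R));
    last exact: cvgr_expR.
  by apply: gt0_cvgMry; rewrite ?invr_gt0.
Unshelve. all: by end_near. Qed.

Let gI_cvg0 (a : R) : 0 < a -> x `^ a * expR (- x) @[x --> 0^'+] --> 0.
Proof.
move=> a0.
have cE : expR (- x) @[x --> 0^'+] --> expR (- (1 * 0) : R).
  have -> : (fun x : R => expR (- x)) = (fun x => expR (- (1 * x))).
    by apply/funext => x; rewrite mul1r.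
  by apply: cvg_at_right_filter; exact: continuous_expRNM.
have := cvgM (powR_cvg0 a0) cE; rewrite mul0r; exact.
Qed.

Let is_derive_expRN (x : R) : is_derive x 1 (fun y : R => - expR (- y)) (expR (- x)).
Proof. by apply: is_derive_eq; rewrite /GRing.scale/= mulrN1 opprK. Qed.

(** The segment stays away from 0, so the powers of x are smooth on it for every exponent. *)
Let by_parts (a u v : R) : 0 < a -> 0 < u -> u < v ->
  (\int[mu]_(x in `[u, v]) (gI (a + 1) x)%:E =
   (u `^ a * expR (- u) - v `^ a * expR (- v))%:E +
   a%:E * \int[mu]_(x in `[u, v]) (gI a x)%:E)%E.
Proof.
move=> a0 u0 uv.
have v0 := lt_trans u0 uv.
have cP (p x : R) : 0 < x -> {for x, continuous (fun y : R => y `^ p)}.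
  move=> x0; apply: differentiable_continuous; apply/derivable1_diffP.
  by apply: derivable_powR; rewrite in_itv/= x0.
have cE (x : R) : {for x, continuous (fun y : R => expR (- y))}.
  have -> : (fun y : R => expR (- y)) = (fun y => expR (- (1 * y))).
    by apply/funext => y; rewrite mul1r.
  exact: continuous_expRNM.
have cNE (x : R) : {for x, continuous (fun y : R => - expR (- y))}.
  exact/continuousN/cE.
have gt0 x : x \in `]u, v[ -> 0 < x by rewrite in_itv/= => /andP[/(lt_trans u0)].
under eq_integral do rewrite /gI addrK.
rewrite (@integration_by_parts R (fun y => y `^ a) (fun y => - expR (- y))
  (fun x => a * x `^ (a - 1)) (fun y => expR (- y)) u v uv).
- rewrite -ge0_integralZl//=; last 3 first.
  + exact: measurable_gI.
  + by move=> x _; rewrite lee_fin.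
  + by rewrite lee_fin ltW.
  congr (_ + _)%E; first by congr (_%:E); ring.
  under eq_integral => x _ do rewrite mulrN EFinN -mulrA EFinM.
  rewrite integral_ge0N ?oppeK//= => x _.
  by rewrite -EFinM lee_fin mulr_ge0 ?gI_ge0 ?(ltW a0).
- apply: continuous_in_subspaceT => x /set_mem/=; rewrite in_itv/= => /andP[ux _].
  by apply: cvgM; [exact: cvg_cst|apply: cP; exact: lt_le_trans ux].
- split; [by move=> x /gt0 x0; apply: derivable_powR; rewrite in_itv/= x0| |].
  + exact/cvg_at_right_filter/cP.
  + exact/cvg_at_left_filter/cP.
- by move=> x /gt0 x0; apply: powR_derive1; rewrite in_itv/= x0.
- by apply: continuous_subspaceT => x; exact: cE.
- split; [by move=> x _; have [] := is_derive_expRN x| |].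
  + exact/cvg_at_right_filter/cNE.
  + exact/cvg_at_left_filter/cNE.
- by move=> x _; rewrite derive1E; have [_ ->] := is_derive_expRN x.
Qed.

(* For a < 1 the integrand of Gamma a is unbounded at 0, hence the exhaustion
   of ]0, +oo[ by the segments [1/(n+2), n+2]. *)
Let JS (a : R) : 0 < a -> (J (a + 1) = a%:E * J a)%E.
Proof.
move=> a0.
pose v (n : nat) : R := n.+2%:R.
pose D n : set R := `[(v n)^-1, v n]%classic.
have v0 n : 0 < v n by rewrite ltr0n.
have DU : \bigcup_n D n = `]0%R, +oo[%classic.
  apply/seteqP; split => [x [n _]|x]/=.
    rewrite /D/= !in_itv/= => /andP[+ _]; rewrite andbT; apply: lt_le_trans.
    by rewrite invr_gt0.
  rewrite in_itv/= andbT => x0; exists (maxn (Num.bound x) (Num.bound x^-1)) => //.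
  have le (y : R) n : 0 <= y -> (Num.bound y <= n)%N -> y <= v n.
    move=> y0 yn; rewrite (le_trans (ltW (archi_boundP y0)))// ler_nat.
    by rewrite (leq_trans yn)// -addn2 leq_addr.
  rewrite /D/= in_itv/=; apply/andP; split.
    rewrite -[leRHS]invrK lef_pV2 ?posrE ?invr_gt0//.
    by rewrite le ?leq_maxr// invr_ge0 ltW.
  by rewrite le ?leq_maxl// ltW.
have ndD : nondecreasing_seq D.
  move=> m n mn; apply/subsetPset => x; rewrite /D/= !in_itv/= => /andP[mx xm].
  have vmn : v m <= v n by rewrite ler_nat !ltnS.
  rewrite (le_trans _ mx) ?(le_trans xm)//.
  by rewrite lef_pV2 ?posrE.
(* Monotone convergence, valid whether or not the limit is finite. *)
have cvJ p : (\int[mu]_(x in D n) (gI p x)%:E)%E @[n --> \oo] --> J p.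
  rewrite /J -DU; apply: ge0_nondecreasing_set_cvg_integral => //=.
  - by move=> n; exact: measurable_itv.
  - by move=> n; exact: measurable_gI.
  - by move=> n x _; rewrite lee_fin.
have cvy : v n @[n --> \oo] --> +oo.
  apply/cvgryPge => x; near=> n.
  by rewrite (le_trans (ler_norm x))// (le_trans (ltW (archi_boundP (normr_ge0 x))))//
    ler_nat -[n.+2]addn2; apply: leq_trans (leq_addr _ _); near: n; exact: nbhs_infty_ge.
(* The boundary terms of the integration by parts vanish at both ends. *)
have cvb : (((v n)^-1 `^ a * expR (- (v n)^-1) - v n `^ a * expR (- v n))%:E)
    @[n --> \oo] --> 0%:E.
  apply: cvg_EFin; first exact: nearW.
  rewrite -[0](subr0 0); apply: cvgB.
    have /cvg_at_rightP := gI_cvg0 _ a0; apply; split => [n|]; first by rewrite invr_gt0.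
    have := @cvg_harmonic R; rewrite -cvg_shiftS; exact.
  have /cvg_pinftyP := gI_cvgy _ a0; exact.
have /cvg_unique := cvJ (a + 1); apply => //.
have -> : (fun n => \int[mu]_(x in D n) (gI (a + 1) x)%:E)%E = (fun n =>
    ((v n)^-1 `^ a * expR (- (v n)^-1) - v n `^ a * expR (- v n))%:E +
    a%:E * \int[mu]_(x in D n) (gI a x)%:E)%E.
  apply/funext => n; apply: by_parts; rewrite ?invr_gt0//.
  by rewrite (@lt_trans _ _ 1)// ?invf_lt1 ?ltr1n.
rewrite -[(a%:E * J a)%E]add0e; apply: cvgeD => //.
exact: cvgeZl.
Unshelve. all: by end_near. Qed.

(** Since J (a + 1) = a * J a is positive and finite, so is J a; the singularity at 0 for a < 1 thus
    needs no estimate of its own. *)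
Let J_gt0_lty (a : R) : 0 < a -> (0 < J a < +oo)%E.
Proof.
move=> a0; have := JS_gt0 _ a0; have := JS_lty _ a0; rewrite JS//.
case: (J a) => [r| |] //=.
- by move=> _; rewrite -EFinM !lte_fin ltry pmulr_rgt0// => ->.
- by rewrite gt0_muley ?lte_fin// ltxx.
- by rewrite gt0_muleNy ?lte_fin.
Qed.

Lemma Gamma_gt0 (a : R) : 0 < a -> 0 < Gamma a.
Proof. by move=> /J_gt0_lty; exact: fine_gt0. Qed.

Lemma GammaS (a : R) : 0 < a -> Gamma (a + 1) = a * Gamma a.
Proof.
move=> a0; rewrite /Gamma /Rintegral -[X in fine X]/(J (a + 1)) JS//.
by rewrite fineM// -/(J a) gt0_fin_numE; have /andP[] := J_gt0_lty _ a0.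
Qed.

End GammaFunction.

(** * Duality of the generator *)

(** Vandermonde's identity multiplied by k!. *)
Lemma ffactD (a b k : nat) :
  ((a + b) ^_ k = \sum_(i < k.+1) 'C(k, i) * (a ^_ (k - i) * b ^_ i))%N.
Proof.
rewrite -bin_ffact addnC -binomial.Vandermonde big_distrl/=.
apply: eq_bigr => i _; have ik : (i <= k)%N by rewrite -ltnS.
by rewrite -(bin_fact ik) -!bin_ffact; ring.
Qed.

(** Pascal's rule. With K and n - K as separate arguments of F, each half is the sum for n with one
    argument shifted. *)
Lemma sum_binS (V : pzRingType) (F : nat -> nat -> V) (n : nat) :
  \sum_(K < n.+2) 'C(n.+1, K)%:R * F K (n.+1 - K)%N =
  \sum_(K < n.+1) 'C(n, K)%:R * F K (n - K).+1 +
  \sum_(K < n.+1) 'C(n, K)%:R * F K.+1 (n - K)%N.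
Proof.
rewrite big_ord_recl bin0.
under eq_bigr do rewrite lift0 binS natrD mulrDl subSS.
rewrite big_split/= addrA; congr (_ + _).
rewrite [in RHS]big_ord_recl bin0 !subn0; congr (_ + _).
rewrite big_ord_recr /= bin_small // mul0r addr0.
by apply: eq_bigr => K _; rewrite subnSK.
Qed.

Definition beta_of {R : realType} (g : R -> R) (s t : R) : R :=
  g s * g t / g (s + t).

(** * Moments of the beta-binomial distribution, for an abstract Gamma function [g] *)

Section BetaBinomial.
Context {R : realType}.
Variable g : R -> R.
Hypothesis g_gt0 : forall a, 0 < a -> 0 < g a.
Hypothesis gS : forall a, 0 < a -> g (a + 1) = a * g a.
Implicit Types (s t : R) (n j p : nat).

Let addn_gt0 s n : 0 < s -> 0 < s + n%:R.
Proof. by move=> s0; rewrite ltr_pwDl. Qed.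

(** Induction on n for all s and t: Pascal's rule splits the sum into those for n at (s, t + 1) and
    (s + 1, t). *)
Lemma sum_bin_Gamma s t n : 0 < s -> 0 < t ->
  (\sum_(K < n.+1) 'C(n, K)%:R * (g (K%:R + s) * g ((n - K)%:R + t))) *
    g (s + t) = g s * g t * g (s + t + n%:R).
Proof.
elim: n s t => [|n IH] s t s0 t0; first by rewrite big_ord1 bin0 mul1r !add0r addr0.
have st0 : 0 < s + t by rewrite addr_gt0.
rewrite (sum_binS _ (fun K M => g (K%:R + s) * g (M%:R + t))).
have /= := IH s (t + 1) s0; have /= := IH (s + 1) t.
have -> : s + 1 + t = s + t + 1 by ring.
have -> : s + (t + 1) = s + t + 1 by ring.
have -> : s + t + 1 + n%:R = s + t + n.+1%:R by rewrite -natr1; ring.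
rewrite (gS _ s0) (gS _ t0) (gS _ st0).
move=> /(_ (addr_gt0 s0 ltr01) t0) E1 /(_ (addr_gt0 t0 ltr01)) E2.
have st1 : s + t != 0 by rewrite gt_eqF.
(* The factor s + t, which comes from g (s + t + 1), is distributed on the right: one term for each
   half of the sum. *)
apply: (mulfI st1).
have -> : (s + t) * (g s * g t * g (s + t + n.+1%:R)) =
  s * g s * g t * g (s + t + n.+1%:R) +
  g s * (t * g t) * g (s + t + n.+1%:R) by ring.
rewrite -E1 -E2 -mulrDl [LHS]mulrCA [in RHS]addrC; congr (_ * _).
congr (_ + _); apply: eq_bigr => K _; rewrite -natr1.
  by have -> : (n - K)%:R + 1 + t = (n - K)%:R + (t + 1) by ring.
by have -> : K%:R + 1 + s = K%:R + (s + 1) by ring.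
Qed.

Let moment s t n j p :=
  \sum_(K < n.+1) 'C(n, K)%:R * (K ^_ j * (n - K) ^_ p)%:R *
    (g (K%:R + s) * g ((n - K)%:R + t)).

Let momentE n j p := forall s t, 0 < s -> 0 < t ->
  moment s t n j p * g (s + t + (j + p)%:R) =
  (n ^_ (j + p))%:R * (g (s + j%:R) * g (t + p%:R) * g (s + t + n%:R)).

(* Absorption, K * 'C(n, K) = n * 'C(n - 1, K - 1), shifts s to s + 1. *)
Let momentES n j p : momentE n j p -> momentE n.+1 j.+1 p.
Proof.
move=> IH s t s0 t0; have := IH (s + 1) t.
rewrite addr_gt0// => /(_ isT t0).
have -> : s + 1 + t + (j + p)%:R = s + t + (j.+1 + p)%:R.
  by rewrite addSn -natr1; ring.
have -> : s + 1 + t + n%:R = s + t + n.+1%:R by rewrite -natr1; ring.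
have -> : s + 1 + j%:R = s + j.+1%:R by rewrite -natr1; ring.
move=> E; rewrite addSn ffactSS natrM -mulrA -E mulrA; congr (_ * _).
rewrite /moment big_ord_recl ffact0n mul0n mulr0 mul0r add0r mulr_sumr.
apply: eq_bigr => K _; rewrite lift0 subSS ffactSS !mulrA -!natrM.
rewrite !mulnA [('C(_, _) * _)%N]mulnC mul_bin_diag -!mulnA -natr1.
by have -> : K%:R + 1 + s = K%:R + (s + 1) by ring.
Qed.

(** Induction on j; for n = 0 both sides vanish, since [0 ^_ j.+1] is 0. *)
Let momentE0 j p : (forall n, momentE n 0 p) -> forall n, momentE n j p.
Proof.
move=> E0; elim: j => [//|j IH] [|n]; last exact: momentES.
move=> s t _ _; rewrite /moment big_ord1 addSn !ffact0n mul0n.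
by rewrite mulr0 !mul0r.
Qed.

(** The reflection K -> n - K. *)
Let moment_sym s t n j p : moment s t n j p = moment t s n p j.
Proof.
rewrite /moment (reindex_inj rev_ord_inj)/=; apply: eq_bigr => K _.
have Kn : (K <= n)%N by rewrite -ltnS.
by rewrite subSS bin_sub// subKn// mulnC [X in _ * X]mulrC.
Qed.

(** Absorption raises the first exponent only, so the exponents go from (0, 0) to (p, 0), by
    reflection to (0, p), and then to (j, p). *)
Lemma sum_bin_ffact_Gamma n j p s t : 0 < s -> 0 < t ->
  (\sum_(K < n.+1) 'C(n, K)%:R * (K ^_ j * (n - K) ^_ p)%:R *
    (g (K%:R + s) * g ((n - K)%:R + t))) * g (s + t + (j + p)%:R) =
  (n ^_ (j + p))%:R * (g (s + j%:R) * g (t + p%:R) * g (s + t + n%:R)).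
Proof.
have E00 n' : momentE n' 0 0.
  move=> s' t' s0 t0; rewrite !addr0 ffactn0 mul1r -sum_bin_Gamma//.
  by congr (_ * _); apply: eq_bigr => K _; rewrite muln1 mulr1.
apply: momentE0 => n' s' t' s0 t0; rewrite moment_sym.
have := momentE0 p 0%N E00 n' _ _ t0 s0.
rewrite addn0 add0n [t' + s']addrC => ->.
by rewrite addr0; ring.
Qed.

(** For [g] = Gamma, the binomial weight averaged over a Beta(s, t) success probability. *)
Definition beta_binomial s t n K : R :=
  'C(n, K)%:R * (g (K%:R + s) * g ((n - K)%:R + t)) /
  (beta_of g s t * g (s + t + n%:R)).

Lemma beta_binomial_moment n j p s t : 0 < s -> 0 < t ->
  \sum_(K < n.+1) beta_binomial s t n K * (K ^_ j * (n - K) ^_ p)%:R =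
  (n ^_ (j + p))%:R * (g (j%:R + s) * g (p%:R + t)) /
  (beta_of g s t * g (s + t + (j + p)%:R)).
Proof.
move=> s0 t0; have st0 : 0 < s + t by rewrite addr_gt0.
have Gn k : g (s + t + k%:R) != 0 by rewrite gt_eqF// g_gt0// addn_gt0.
have B0 : beta_of g s t != 0 by rewrite gt_eqF// /beta_of divr_gt0 ?mulr_gt0 ?g_gt0.
apply: (mulIf (Gn (j + p)%N)); apply: (mulIf (Gn n)); apply: (mulIf B0).
transitivity ((n ^_ (j + p))%:R *
  (g (s + j%:R) * g (t + p%:R) * g (s + t + n%:R))).
  rewrite -sum_bin_ffact_Gamma//.
  rewrite (mulrAC _ _ (g (s + t + n%:R))) (mulrAC _ _ (beta_of g s t)); congr (_ * _).
  rewrite -mulrA mulr_suml; apply: eq_bigr => K _; rewrite /beta_binomial.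
  by field; rewrite B0 Gn.
rewrite [s + _]addrC [t + _]addrC; field.
by rewrite B0 ?Gn.
Qed.

Lemma sum_beta_binomial n s t : 0 < s -> 0 < t ->
  \sum_(K < n.+1) beta_binomial s t n K = 1.
Proof.
move=> s0 t0; have st0 : 0 < s + t by rewrite addr_gt0.
have := beta_binomial_moment n 0 0 s t s0 t0.
under eq_bigr do rewrite muln1 mulr1; move=> ->.
rewrite ffactn0 mul1r !add0r addr0 /beta_of; field.
by rewrite !gt_eqF ?g_gt0.
Qed.

(** The falling factorial is 0 for n < k, which is the convention that [duality1] states by
    cases. *)
Definition duality_of s t k n : R := (n ^_ k)%:R * (g (s + t) / g (s + t + k%:R)).

(** Vandermonde turns the left side into a sum over (i, j) of a moment of K times a moment of L.
    Their [g] values, regrouped crosswise, are the weights of i and j. *)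
Lemma beta_binomial_duality s t n m k l : 0 < s -> 0 < t ->
  \sum_(K < n.+1) \sum_(L < m.+1)
    beta_binomial s t n K * beta_binomial s t m L *
    (duality_of s t k (n - K + L) * duality_of s t l (m - L + K)) =
  \sum_(i < k.+1) \sum_(j < l.+1)
    beta_binomial s t k i * beta_binomial s t l j *
    (duality_of s t (k - i + j) n * duality_of s t (l - j + i) m).
Proof.
move=> s0 t0; have st0 : 0 < s + t by rewrite addr_gt0.
have gn j : g (s + t + j%:R) != 0 by rewrite gt_eqF// g_gt0// addn_gt0.
have B0 : beta_of g s t != 0 by rewrite gt_eqF// /beta_of divr_gt0 ?mulr_gt0 ?g_gt0.
pose c := (g (s + t) / g (s + t + k%:R)) * (g (s + t) / g (s + t + l%:R)).
(* Here i is the number of factors that the falling factorial of n - K + L takes from L, and j the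
   number that the one of m - L + K takes from K. *)
pose T (K : 'I_n.+1) (L : 'I_m.+1) (i : 'I_k.+1) (j : 'I_l.+1) :=
  c * ('C(k, i)%:R * 'C(l, j)%:R) *
  ((beta_binomial s t n K * (K ^_ j * (n - K) ^_ (k - i))%:R) *
   (beta_binomial s t m L * (L ^_ i * (m - L) ^_ (l - j))%:R)).
transitivity (\sum_K \sum_L \sum_i \sum_j T K L i j).
  apply: eq_bigr => K _; apply: eq_bigr => L _.
  rewrite /duality_of !ffactD !natr_sum.
  rewrite [X in _ * X = _]mulrACA -/c big_distrlr/= mulr_suml mulr_sumr.
  apply: eq_bigr => i _; rewrite mulr_suml mulr_sumr; apply: eq_bigr => j _.
  by rewrite /T !natrM; ring.
rewrite pair_big/=; under eq_bigr do rewrite pair_big/=.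
rewrite exchange_big [RHS]pair_big/=; apply: eq_bigr => -[i j] _ /=.
rewrite -(pair_big xpredT xpredT (fun K L => T K L i j))/= /T.
under eq_bigr do rewrite -mulr_sumr.
(* The moment of K yields g (j + s) and g (k - i + t), that of L yields g (i + s) and g (l - j + t);
   the weights of i and of j each take one factor from either. *)
rewrite -mulr_sumr -big_distrlr/= !beta_binomial_moment//.
rewrite [(i + _)%N]addnC [(j + _)%N]addnC.
rewrite /duality_of /beta_binomial /c.
have := gn k; have := gn l; have := gn (k - i + j)%N; have := gn (l - j + i)%N.
move: (g (s + t + k%:R)) (g (s + t + l%:R)) => x1 x2.
move: (g (s + t + (k - i + j)%:R)) (g (s + t + (l - j + i)%:R)) => x3 x4.
by move=> *; field; do ?[apply/andP; split].
Qed.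

End BetaBinomial.

Lemma rateE (R : realType) (s t : R) (n m K L : nat) : (K <= n)%N -> (L <= m)%N ->
  rate s t n m K L = beta_binomial (@Gamma R) s t n K * beta_binomial (@Gamma R) s t m L.
Proof.
move=> Kn Lm; rewrite /rate /beta_binomial -[beta_of _ s t]/(Beta s t).
rewrite -(bin_fact Kn) -(bin_fact Lm) !natrM.
set x := Beta s t; set g1 := Gamma (_ + n%:R); set g2 := Gamma (_ + m%:R).
set h1 := Gamma (K%:R + _); set h2 := Gamma ((m - L)%:R + _).
set h3 := Gamma ((n - K)%:R + _); set h4 := Gamma (L%:R + _).
move: x g1 g2 h1 h2 h3 h4 => x g1 g2 h1 h2 h3 h4.
have f0 k : k`!%:R != 0 :> R by rewrite pnatr_eq0 -lt0n fact_gt0.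
move: (f0 K) (f0 (n - K)%N) (f0 L) (f0 (m - L)%N).
move: (K`!)%:R ((n - K)`!)%:R (L`!)%:R ((m - L)`!)%:R => a1 a2 a3 a4 a10 a20 a30 a40.
(* The quotients of each factorial by itself are kept, which leaves an identity for [ring] with the
   inverses as atoms. *)
transitivity (('C(n, K)%:R * (h1 * h3) / (x * g1)) *
  ('C(m, L)%:R * (h4 * h2) / (x * g2)) *
  (a1 / a1) * (a2 / a2) * (a3 / a3) * (a4 / a4)).
  by rewrite !invfM; ring.
by rewrite !divff// !mulr1.
Qed.

(** * The generator of the chain *)

Section GeneratorDuality.
Context {R : realType}.
Variables s t : R.
Hypotheses (s0 : 0 < s) (t0 : 0 < t).
Implicit Types (f : nat * nat -> R) (x y : nat * nat).

Let bb := beta_binomial (@Gamma R) s t.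

Lemma duality1E k n : duality1 s t k n = duality_of (@Gamma R) s t k n.
Proof.
rewrite /duality1 /duality_of; case: leqP => [kn|nk]; last first.
  by rewrite ffact_small// mul0r.
rewrite -(ffact_fact kn) natrM mulfK// pnatr_eq0 -lt0n; exact: fact_gt0.
Qed.

(** The rates have total mass 1, so the subtracted terms add up to the present value of f. *)
Lemma generatorE f n m : generator s t f (n, m) =
  \sum_(K < n.+1) \sum_(L < m.+1)
    bb n K * bb m L * f ((n - K + L)%N, (m - L + K)%N) - f (n, m).
Proof.
have st0 : 0 < s + t by rewrite addr_gt0.
rewrite /generator big_mkord.
have fE : f (n, m) = \sum_(K < n.+1) \sum_(L < m.+1) bb n K * bb m L * f (n, m).
  under eq_bigr do rewrite -mulr_suml -mulr_sumr.
  rewrite -mulr_suml -mulr_suml /bb.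
  by rewrite !(sum_beta_binomial _ (@Gamma_gt0 R) (@GammaS R) _ _ _ s0 t0) !mul1r.
rewrite [in RHS]fE -sumrB; apply: eq_bigr => K _; rewrite big_mkord -sumrB.
apply: eq_bigr => L _.
have Kn : (K <= n)%N by rewrite -ltnS.
have Lm : (L <= m)%N by rewrite -ltnS.
by rewrite (rateE _ _ _ _ _ _ _ Kn Lm) mulrBr.
Qed.

(** The subtracted terms on the two sides are the same value of [duality]; the averages agree by
    [beta_binomial_duality]. *)
Lemma generator_duality x y :
  generator s t (duality s t y) x = generator s t (fun z => duality s t z x) y.
Proof.
case: x y => [n m] [k l]; rewrite !generatorE /duality/=; congr (_ - _).
under eq_bigr do under eq_bigr do rewrite !duality1E.
under [RHS]eq_bigr do under eq_bigr do rewrite !duality1E.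
exact: (beta_binomial_duality _ (@Gamma_gt0 R) (@GammaS R)).
Qed.

(** Every jump preserves the sum of the coordinates. *)
Lemma eq_generator f1 f2 n m :
  (forall i j, (i + j = n + m)%N -> f1 (i, j) = f2 (i, j)) ->
  generator s t f1 (n, m) = generator s t f2 (n, m).
Proof.
move=> eqf; rewrite !generatorE eqf//; congr (_ - _).
apply: eq_bigr => K _; apply: eq_bigr => L _; congr (_ * _); apply: eqf.
by have := ltn_ord K; have := ltn_ord L; lia.
Qed.

Lemma generator_cst (a : R) x : generator s t (fun=> a) x = 0.
Proof.
case: x => n m; rewrite /generator big1// => K _; rewrite big1// => L _.
by rewrite subrr mulr0.
Qed.

End GeneratorDuality.

(** * From the generator to the chain *)

(* Subdividing [0, r] into n + 1 pieces bounds |g i r| by r * o(1). *)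
Lemma subadditive_family_eq0 {R : realType} (I : finType) (g : I -> R -> R) :
  (forall u r a b, 0 < u -> 0 < r -> (forall i, `|g i u| <= a) ->
    (forall i, `|g i r| <= b) -> forall i, `|g i (u + r)| <= a + b) ->
  (forall i, g i r / r @[r --> 0^'+] --> 0) ->
  forall i r, 0 < r -> g i r = 0.
Proof.
move=> gD g0 i r r0; apply/eqP; rewrite -normr_le0; apply/ler_addgt0Pr => e e0.
rewrite add0r.
pose h (n : nat) : R := r * n.+1%:R^-1.
have hgt0 n : 0 < h n by rewrite mulr_gt0// invr_gt0.
have h0 : h n @[n --> \oo] --> 0.
  by rewrite -(mulr0 r); apply: cvgMl_tmp; exact: cvg_harmonic.
(* Finiteness of I gives one n that serves all j. *)
have ghe : \forall n \near \oo, forall j, `|g j (h n) / h n| <= e / r.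
  apply: filter_forall => j.
  have /cvg_at_rightP/(_ h (conj hgt0 h0)) := g0 j.
  move=> /cvgrPdist_le/(_ (e / r)); rewrite divr_gt0// => /(_ isT).
  by apply: filterS => n; rewrite sub0r normrN.
have [n ghn] := @filter_ex _ _ _ _ ghe.
have gh j : `|g j (h n)| <= e / r * h n.
  have := ghn j; rewrite normrM normfV (gtr0_norm (hgt0 n)).
  by rewrite ler_pdivrMr.
(* Multiples start at 1 because subadditivity is assumed at positive times only. *)
have gk m : forall j, `|g j (m.+1%:R * h n)| <= m.+1%:R * (e / r * h n).
  elim: m => [|m IH] j; first by rewrite !mul1r.
  by rewrite -natr1 !mulrDl !mul1r; apply: gD => //; rewrite mulr_gt0.
have := gk n i; rewrite /h [n.+1%:R * _]mulrC divfK ?pnatr_eq0//.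
have -> // : n.+1%:R * (e / r * (r * n.+1%:R^-1)) = e.
have n0 : n.+1%:R != 0 :> R by rewrite pnatr_eq0.
by move: n.+1%:R n0 => c c0; field; rewrite c0 gt_eqF.
Qed.

Lemma measurable_nat2 (A : set (nat * nat)) : measurable A.
Proof.
apply: countable_measurable; last exact: countableP.
move=> [a b]; rewrite (_ : [set _] = [set a] `*` [set b]); first exact: measurableX.
by apply/seteqP; split => -[x y] /= [-> ->].
Qed.

Lemma probability_bigcup_fin {R : realType} d (T : measurableType d)
    (Q : probability T R) (I : finType) (F : I -> set T) :
  (forall i, measurable (F i)) -> trivIset [set: I] F ->
  Q (\bigcup_(i in [set: I]) F i) = (\sum_i fine (Q (F i)))%:E.
Proof.
move=> mF tF; rewrite measure_fin_bigcup//; last exact: finite_finset.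
rewrite (fsbigE (index_enum I)) ?index_enum_uniq//=; last first.
  by move=> i _; rewrite mem_index_enum.
rewrite -sumEFin; apply: eq_big => [i|i _]; first by rewrite in_setT.
by rewrite fineK// fin_num_measure.
Qed.

Lemma expectation_simple {R : realType} d (T : measurableType d)
    (Q : probability T R) (I : finType) (c : I -> R) (F : I -> set T) :
  (forall i, measurable (F i)) ->
  ('E_Q[fun w => (\sum_i c i * \1_(F i) w)%R] =
   (\sum_i c i * fine (Q (F i)))%R%:E)%E.
Proof.
move=> mF; rewrite unlock.
under eq_integral do rewrite -sumEFin.
rewrite integral_sum//; last first.
  move=> i; under eq_fun do rewrite EFinM.
  by apply: integrableZl => //; exact: integrable_indic.
rewrite -sumEFin; apply: eq_bigr => i _.
under eq_integral do rewrite EFinM.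
rewrite integralZl//; last exact: integrable_indic.
by rewrite integral_indic// setIT EFinM fineK// fin_num_measure.
Qed.

(* The last two clauses say that no jump leaves the range of e. *)
Definition closed_enum {R : realType} (L : (nat * nat -> R) -> nat * nat -> R)
    {I : finType} (e : I -> nat * nat) :=
  [/\ injective e, forall i, L (fun=> 1) (e i) = 0 &
    forall f h i, (forall j, f (e j) = h (e j)) -> L f (e i) = L h (e i)].

Definition transition {R : realType} {d : measure_display}
    {Omega : measurableType d} (P : nat * nat -> probability Omega R)
    (X : R -> Omega -> nat * nat) (r : R) (x z : nat * nat) : R :=
  fine (P x [set w | X r w = z]).

(** * Transition probabilities on a finite closed class *)

Section ClosedClass.
Context {R : realType} {d : measure_display} {Omega : measurableType d}.
Context {L : (nat * nat -> R) -> nat * nat -> R}.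
Context {P : nat * nat -> probability Omega R} {X : R -> Omega -> nat * nat}.
Hypothesis hX : is_markov_chain L P X.

Lemma measurable_fiber r z : 0 <= r -> measurable [set w | X r w = z].
Proof.
move=> r0; have := chain_measurable hX r0 measurableT (measurable_nat2 [set z]).
by rewrite setTI.
Qed.

Local Notation transition := (transition P X).

Lemma transition_ge0 r x z : 0 <= transition r x z.
Proof. exact: fine_ge0. Qed.

(** The Markov property with an empty list of past observations. *)
Lemma chapman_kolmogorov_joint u r x y z : 0 <= u -> 0 <= r ->
  fine (P x ([set w | X u w = y] `&` [set w | X (u + r) w = z])) =
  transition u x y * transition r y z.
Proof.
move=> u0 r0; have := @chain_markov _ _ _ _ _ _ hX x y z [::] u r u0 r0.
have -> : [set w | X u w = y /\ forall e : R * (nat * nat), e \in [::] -> X e.1 w = e.2] =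
    [set w | X u w = y] by apply/seteqP; split => w //= [].
move=> ->; last by [].
by rewrite fineM// fin_num_measure//; exact: measurable_fiber.
Qed.

Context {I : finType} {e : I -> nat * nat}.
Hypothesis eL : closed_enum L e.

Let e_inj : injective e. Proof. by case: eL. Qed.

Let pm r i j := transition r (e i) (e j).

Let trivI u (A : set Omega) :
  trivIset [set: I] (fun k => [set w | X u w = e k] `&` A).
Proof.
by move=> i j _ _ [w [[/= wi _] [/= wj _]]]; apply: e_inj; rewrite -wi -wj.
Qed.

(** Only an inequality, since nothing yet confines X to the range of e. *)
Let sum_joint_le Q (A : set Omega) u : 0 <= u -> measurable A ->
  \sum_k fine (P Q ([set w | X u w = e k] `&` A)) <= fine (P Q A).
Proof.
move=> u0 mA; rewrite -lee_fin -probability_bigcup_fin; last exact: trivI.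
  rewrite fineK ?fin_num_measure//; apply: le_measure; rewrite ?inE//.
    apply: fin_bigcup_measurable; first exact: finite_finset.
    by move=> k _; apply: measurableI => //; exact: measurable_fiber.
  by apply: bigcup_sub => k _ w [].
by move=> k; apply: measurableI => //; exact: measurable_fiber.
Qed.

Let sum_pm_le1 r i : 0 <= r -> \sum_j pm r i j <= 1.
Proof.
move=> r0; have := sum_joint_le (e i) _ _ r0 measurableT.
rewrite probability_setT/=; apply: le_trans.
by apply: ler_sum => j _; rewrite setIT.
Qed.

(** Paths outside the range of e at time u are dropped; equality is [chapman_kolmogorov], once no
    mass can escape. *)
Let pmD_ge u r i j : 0 <= u -> 0 <= r ->
  \sum_k pm u i k * pm r k j <= pm (u + r) i j.
Proof.
move=> u0 r0; have ur0 : 0 <= u + r by rewrite addr_ge0.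
apply: le_trans (sum_joint_le _ _ _ u0 (measurable_fiber _ _ ur0)).
by apply: ler_sum => k _; rewrite chapman_kolmogorov_joint.
Qed.

Lemma derive_transition (f : nat * nat -> R) i :
  (\sum_j f (e j) * transition r (e i) (e j) - f (e i)) / r @[r --> 0^'+]
    --> L f (e i).
Proof.
case: eL => _ _ loc.
(* f cut off outside the range of e: bounded, as [chain_generator] requires, and with the same image
   under L at e i. *)
pose fe (z : nat * nat) : R := \sum_j f (e j) * (z == e j)%:R.
have feE j : fe (e j) = f (e j).
  rewrite /fe (bigD1 j)//= eqxx mulr1 big1 ?addr0// => k kj.
  by rewrite inj_eq// eq_sym (negbTE kj) mulr0.
rewrite -(loc fe f i feE).
have bnd : exists C : R, forall y, `|fe y| <= C.
  exists (\sum_j `|f (e j)|) => y; rewrite (le_trans (ler_norm_sum _ _ _))//.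
  apply: ler_sum => j _; rewrite normrM ler_piMr//.
  by case: (_ == _); rewrite ?normr1 ?normr0.
have := chain_generator hX (x := e i) bnd; rewrite feE; apply: cvg_trans.
apply: near_eq_cvg; near=> r.
have r0 : 0 <= r by apply: ltW; near: r; exact: nbhs_right_gt.
congr ((_ - _) / _).
have -> : (fun w => fe (X r w)) =
    (fun w => \sum_j f (e j) * \1_[set w | X r w = e j] w).
  apply/funext => w; apply: eq_bigr => j _; rewrite indicE; congr (_ * (nat_of_bool _)%:R).
  by apply/eqP/idP; rewrite inE.
by rewrite expectation_simple// => j; exact: measurable_fiber.
Unshelve. all: by end_near. Qed.

(** The escaped mass is nonnegative, subadditive in time by [pmD_ge], and o(r) at 0 because L sends
    the constant 1 to 0 on the class. *)
Lemma sum_transition r i : 0 < r -> \sum_j transition r (e i) (e j) = 1.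
Proof.
move=> r0; apply/esym/eqP; rewrite -subr_eq0; apply/eqP.
pose g i r := 1 - \sum_j pm r i j.
have g_ge0 k u : 0 <= u -> 0 <= g k u by move=> u0; rewrite subr_ge0 sum_pm_le1.
rewrite -/(g i r).
apply: (@subadditive_family_eq0 _ I g) => // [u {}r a b /ltW u0 {r0}/ltW r0 ga gb k|k].
  have ur0 : 0 <= u + r by rewrite addr_ge0.
  rewrite ger0_norm ?g_ge0//.
  have -> : a + b = 1 - (1 - a - b) by ring.
  rewrite lerD2l lerN2.
  apply: (@le_trans _ _ (\sum_j \sum_l pm u k l * pm r l j)); last first.
    by apply: ler_sum => j _; exact: pmD_ge.
  rewrite exchange_big/=; under eq_bigr do rewrite -mulr_sumr.
  apply: (@le_trans _ _ (\sum_l pm u k l * (1 - b))).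
    have ua : 1 - a <= \sum_l pm u k l.
      by have := ga k; rewrite ger0_norm ?g_ge0// /g; lra.
    have b0 : 0 <= b by rewrite (le_trans _ (gb k)).
    (* For the total S of the [pm u k l], the bounds 1 - a <= S <= 1 and 0 <= b give S (1 - b) >= 1
       - a - b. *)
    rewrite -mulr_suml; have := sum_pm_le1 u k u0; nra.
  apply: ler_sum => l _; rewrite ler_wpM2l ?transition_ge0//.
  by have := gb l; rewrite ger0_norm ?g_ge0// /g; lra.
have := derive_transition (fun=> 1) k; case: eL => _ -> _.
move=> /cvgN; rewrite oppr0; apply: cvg_trans.
apply: near_eq_cvg; near=> u; rewrite /= -mulNr opprB; congr ((_ - _) / _).
by apply: eq_bigr => j _; rewrite mul1r.
Unshelve. all: by end_near. Qed.

(** By [pmD_ge] the difference of the two sides is nonnegative, and summed over j it gives 1 - 1 =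
    0. *)
Lemma chapman_kolmogorov u r i j : 0 < u -> 0 < r ->
  transition (u + r) (e i) (e j) =
  \sum_k transition u (e i) (e k) * transition r (e k) (e j).
Proof.
move=> u0 r0; have ur0 : 0 < u + r by rewrite addr_gt0.
apply/eqP; rewrite -subr_eq0; apply/eqP.
pose f l := pm (u + r) i l - \sum_k pm u i k * pm r k l.
have f0 l : 0 <= f l by rewrite subr_ge0 pmD_ge ?ltW.
suff /(psumr_eq0P (fun l _ => f0 l))/(_ j isT) : \sum_l f l = 0 by [].
rewrite /f /pm sumrB sum_transition// exchange_big/=.
under eq_bigr do rewrite -mulr_sumr (sum_transition _ _ r0) mulr1.
by rewrite sum_transition// subrr.
Qed.

(** f may be unbounded: almost surely X r lies in the range of e, where f (X r) is a finite
    combination of indicators. *)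
Lemma expectation_transition (f : nat * nat -> R) r i : 0 < r ->
  ('E_(P (e i))[fun w => f (X r w)] =
   (\sum_j f (e j) * transition r (e i) (e j))%R%:E)%E.
Proof.
move=> r0; have rge0 := ltW r0.
rewrite -expectation_simple; last by move=> j; exact: measurable_fiber.
rewrite unlock; apply: ae_eq_integral => //.
- apply/measurable_EFinP.
  have mf : measurable_fun [set: nat * nat] f.
    by move=> _ B _; exact: measurable_nat2.
  exact: measurableT_comp mf (chain_measurable hX rge0).
- apply/measurable_EFinP; apply: measurable_sum => j.
  by apply: measurable_funM => //; apply: measurable_indic; exact: measurable_fiber.
pose S := \bigcup_(j in [set: I]) [set w | X r w = e j].
have mS : measurable S.
  apply: fin_bigcup_measurable; first exact: finite_finset.
  by move=> j _; exact: measurable_fiber.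
exists (~` S); split; first exact: measurableC.
  rewrite [LHS]probability_setC// probability_bigcup_fin.
  - by rewrite sum_transition// subee.
  - by move=> j; exact: measurable_fiber.
  - by move=> j k _ _ [w [/= wj wk]]; apply: e_inj; rewrite -wj -wk.
move=> w /= neq [j _ /= wj]; apply: neq => _; congr (_%:E).
rewrite (bigD1 j)//= big1 ?addr0 => [|k kj]; rewrite indicE.
  by rewrite mem_set// wj mulr1.
rewrite memNset ?mulr0//= wj => /e_inj/eqP; apply/negP.
by rewrite eq_sym.
Qed.

End ClosedClass.

(** Over a time u + r the error is an average of errors at time r plus an average of errors at time
    u. It is o(r) at 0 because both expectations start from the same value of D with equal
    derivatives. *)
Lemma chain_duality {R : realType} {d : measure_display}
    {Omega : measurableType d} {L : (nat * nat -> R) -> nat * nat -> R}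
    {P : nat * nat -> probability Omega R} {X : R -> Omega -> nat * nat}
    {I J : finType} {e : I -> nat * nat} {e' : J -> nat * nat}
    (D : nat * nat -> nat * nat -> R) :
  is_markov_chain L P X -> closed_enum L e -> closed_enum L e' ->
  (forall i j, L (D (e' j)) (e i) = L (fun z => D z (e i)) (e' j)) ->
  forall r i j, 0 < r ->
  ('E_(P (e i))[fun w => D (e' j) (X r w)] =
   'E_(P (e' j))[fun w => D (X r w) (e i)])%E.
Proof.
move=> hX eL e'L LD r i j r0.
rewrite (expectation_transition hX eL (D (e' j)))//.
rewrite (expectation_transition hX e'L (fun z => D z (e i)))//.
congr (_%:E); apply/eqP; rewrite -subr_eq0; apply/eqP.
pose T r k l := transition P X r (e k) (e l).
pose T' r k l := transition P X r (e' k) (e' l).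
pose g (ij : I * J) r := \sum_k D (e' ij.2) (e k) * T r ij.1 k -
                         \sum_k D (e' k) (e ij.1) * T' r ij.2 k.
rewrite -/(g (i, j) r).
apply: (@subadditive_family_eq0 _ _ g) => //.
  move=> u {}r a b u0 {}r0 ga gb [{}i {}j].
  have -> : g (i, j) (u + r) =
      \sum_k T u i k * g (k, j) r + \sum_k T' r j k * g (i, k) u.
    (* The interpolating term: the chain from e i has run for time u, the one from e' j for time
       r. *)
    pose m := \sum_k \sum_l T u i k * (D (e' l) (e k) * T' r j l).
    have -> : \sum_k T u i k * g (k, j) r =
        \sum_k D (e' j) (e k) * T (u + r) i k - m.
      under eq_bigr do rewrite mulrBr; rewrite sumrB; congr (_ - _); last first.
        by apply: eq_bigr => k _; rewrite mulr_sumr.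
      under eq_bigr do rewrite mulr_sumr; rewrite exchange_big/=.
      apply: eq_bigr => l _; rewrite /T (chapman_kolmogorov hX eL)// mulr_sumr.
      by apply: eq_bigr => k _; rewrite mulrCA.
    have -> : \sum_k T' r j k * g (i, k) u =
        m - \sum_k D (e' k) (e i) * T' (u + r) j k.
      under eq_bigr do rewrite mulrBr; rewrite sumrB; congr (_ - _).
        rewrite /m exchange_big/=; apply: eq_bigr => l _; rewrite mulr_sumr.
        by apply: eq_bigr => k _; rewrite mulrC -mulrA mulrCA.
      under eq_bigr do rewrite mulr_sumr; rewrite exchange_big/=.
      apply: eq_bigr => l _.
      (* The chain from e' j runs for time r first, then for time u. *)
      rewrite addrC /T' (chapman_kolmogorov hX e'L)// mulr_sumr.
      by apply: eq_bigr => k _; rewrite mulrCA.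
    by rewrite addrA subrK.
  have bound (K : finType) (t h : K -> R) (c : R) : (forall k, 0 <= t k) ->
      \sum_k t k = 1 -> (forall k, `|h k| <= c) -> `|\sum_k t k * h k| <= c.
    move=> t0 t1 hc; rewrite (le_trans (ler_norm_sum _ _ _))//.
    rewrite -[leRHS]mul1r -t1 mulr_suml; apply: ler_sum => k _.
    by rewrite normrM ger0_norm// ler_wpM2l.
  rewrite addrC (le_trans (ler_normD _ _))// lerD//.
    apply: bound => // [k|]; first exact: transition_ge0.
    exact: (sum_transition hX e'L).
  apply: bound => // [k|]; first exact: transition_ge0.
  exact: (sum_transition hX eL).
move=> [{}i {}j].
have := cvgB (derive_transition hX eL (D (e' j)) i)
             (derive_transition hX e'L (fun z => D z (e i)) j).
rewrite LD subrr => /(_ (at_right_proper_filter 0)) c; apply: cvg_trans c.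
apply: near_eq_cvg; near=> u.
by rewrite /= -mulrBl /g /T /T' /=; congr (_ / _); rewrite opprB addrA subrK.
Unshelve. all: by end_near. Qed.

(** * The levels n + m = N as finite closed classes *)

Definition level (N : nat) (i : 'I_N.+1) : nat * nat := (nat_of_ord i, N - i)%N.

Lemma closed_level {R : realType} (s t : R) (N : nat) :
  0 < s -> 0 < t -> closed_enum (generator s t) (level N).
Proof.
move=> s0 t0; split => [i j [ij _]|i|f h i fh]; first exact: val_inj.
  exact: generator_cst.
apply: eq_generator => // a b; have iN := ltn_ord i; rewrite subnKC// => abN.
have aN : (a < N.+1)%N by lia.
have -> : (a, b) = level N (Ordinal aN) by congr pair => /=; lia.
exact: fh.
Qed.

Theorem mainTheorem11 (R : realType) (s t : R) (hs : 0 < s) (ht : 0 < t)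
  (d : measure_display) (Omega : measurableType d)
  (P : nat * nat -> probability Omega R) (X : R -> Omega -> nat * nat)
  (hX : is_markov_chain (generator s t) P X)
  (k l n m : nat) (r : R) (hr : 0 < r) :
  ('E_(P (n, m))[fun w => duality s t (k, l) (X r w)] =
   'E_(P (k, l))[fun w => duality s t (X r w) (n, m)])%E.
Proof.
have levelP a b : exists i, (a, b) = level (a + b) i.
  have ab : (a < (a + b).+1)%N by lia.
  by exists (Ordinal ab); congr pair => /=; lia.
(* The two starting points may lie on different levels, hence the two enumerations in
   [chain_duality]. *)
have [i ->] := levelP n m; have [j ->] := levelP k l.
apply: (chain_duality (duality s t) hX) hr; [exact: closed_level..|].
by move=> *; exact: generator_duality.
Qed.
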